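(* Let $\Gamma$ be a finitely generated group, with finite generating set $X$, that contains a nonabelian free subgroup. Then $\max\mathrm{D}_{\Gamma,X}(n)\not\preceq\log(n)$; that is, the relation $\max\mathrm{D}_{\Gamma,X}(n)\preceq\log(n)$ does not hold.
   Context: $\|\cdot\|_X$ denotes word length with respect to $X$. For nontrivial $\gamma\in\Gamma$, let $\mathrm{D}_\Gamma(\gamma)=\min\{[\Gamma:\Delta]:\Delta\le\Gamma\text{ a finite index subgroup},\ \gamma\notin\Delta\}$ (subgroups $\Delta$ are not required to be normal; the value is $\infty$ if there is no such $\Delta$). Then $\max\mathrm{D}_{\Gamma,X}(n)$ denotes the maximum of $\mathrm{D}_\Gamma(\gamma)$ over all nontrivial $\gamma\in\Gamma$ with $\|\gamma\|_X\le n$. For functions $f_1,f_2$ on the positive integers with values in $[0,\infty]$, $f_1\preceq f_2$ means that there is a constant $C$ (a positive integer) such that $f_1(n)\le C f_2(Cn)$ for all $n\geq 1$. *)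

(* Defs.v *)
From mathcomp Require Import all_boot all_order all_algebra.
From mathcomp Require Import all_classical all_reals all_analysis.

Set Implicit Arguments.
Unset Strict Implicit.
Unset Printing Implicit Defensive.

Local Open Scope classical_set_scope.

Definition subgroup (G : groupType) (H : set G) : Prop := group_closed (mem H).

Definition generates (G : groupType) (X : set G) : Prop :=
  forall H : set G, subgroup H -> X `<=` H -> H = setT.

(* The letter (x, false) stands for x and the letter (x, true) for x^-1. *)
Definition word_on (G : groupType) (X : set G) (w : seq (G * bool)) : Prop :=
  forall a, a \in w -> X a.1.

Definition word_val (G : groupType) (w : seq (G * bool)) : G :=
  (\prod_(a <- w) (if a.2 then a.1^-1 else a.1))%g.

Definition reduced (G : groupType) (w : seq (G * bool)) : bool :=
  sorted (fun a b => ~~ ((a.1 == b.1) && (a.2 != b.2))) w.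

Definition free_basis (G : groupType) (H S : set G) : Prop :=
  S `<=` H /\
  forall h, H h ->
    exists! w, [/\ word_on S w, reduced w & word_val w = h].

Definition free_subgroup (G : groupType) (H : set G) : Prop :=
  subgroup H /\ exists S : set G, free_basis H S.

Definition nonabelian (G : groupType) (H : set G) : Prop :=
  exists x y, [/\ H x, H y & (x * y <> y * x)%g].

Definition left_cosets (G : groupType) (H : set G) : set (set G) :=
  [set C | exists g, C = [set (g * h)%g | h in H]].

(* [has_index H k]: the subgroup H has finite index, equal to k. *)
Definition has_index (G : groupType) (H : set G) (k : nat) : Prop :=
  (left_cosets H #= `I_k)%card.

Section Growth.
Variable R : realType.
Local Open Scope ereal_scope.

(* The minimum of a set of natural numbers, +oo when the set is empty. *)
Definition nat_min (A : set nat) : \bar R :=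
  ereal_inf [set k%:R%:E | k in A].

Definition word_length (G : groupType) (X : set G) (g : G) : \bar R :=
  nat_min [set k | exists w, [/\ word_on X w, word_val w = g & size w = k]].

Definition divisibility (G : groupType) (g : G) : \bar R :=
  nat_min [set k | exists D : set G, [/\ subgroup D, has_index D k & ~ D g]].

(* A supremum over a ball of radius n; it is a maximum since X is finite
   wherever this is used. *)
Definition max_divisibility (G : groupType) (X : set G) (n : nat) : \bar R :=
  ereal_sup [set divisibility g | g in
    [set g : G | g <> 1%g /\ word_length X g <= n%:R%:E]].

Definition preceq (f1 f2 : nat -> \bar R) : Prop :=
  exists C : nat, (0 < C)%N /\
    forall n : nat, (1 <= n)%N -> f1 n <= C%:R%:E * f2 (C * n)%N.

End Growth.

(* Main.v *)
Require Import Defs.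
From mathcomp Require Import all_boot all_order all_algebra.
From mathcomp Require Import all_classical all_reals all_analysis.
From mathcomp Require Import zify.

(** An element x acting on a set of m = s^2 cosets has orbits whose distinct
    lengths add up to at most m, so there are at most 2s distinct lengths and
    x^e acts trivially for some e among the m^(2s) products of 2s integers in
    [1, m]. For p, q part of a basis of the free subgroup, an iterated
    commutator of conjugates of the powers p^e over all these e, arranged as a
    binary tree, lies in every subgroup of index at most m. It is nontrivial
    because it is given by a reduced word, and its length is
    m^(O(s)) = exp(O(sqrt m log m)), which is subexponential in m. *)

Set Implicit Arguments.
Unset Strict Implicit.
Unset Printing Implicit Defensive.

Import Order.TTheory GRing.Theory Num.Theory.

Local Open Scope classical_set_scope.

(** * Exponents of permutations of small finite sets *)

Fixpoint bounded_products (t m : nat) : seq nat :=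
  if t is t'.+1
  then [seq a * b | a <- iota 1 m, b <- bounded_products t' m]
  else [:: 1].

Lemma size_bounded_products t m : size (bounded_products t m) = m ^ t.
Proof. by elim: t => //= t IHt; rewrite size_allpairs size_iota IHt expnS. Qed.

Lemma bounded_products_bound t m n :
  n \in bounded_products t m -> 0 < n <= m ^ t.
Proof.
elim: t n => [|t IHt] n /=; first by rewrite inE => /eqP->.
move=> /allpairsP [[a b] /= [+ /IHt /andP [b0 bm] ->]].
rewrite mem_iota add1n ltnS => /andP [a0 am].
by rewrite muln_gt0 a0 b0 expnS leq_mul.
Qed.

Lemma prod_in_bounded_products t m (s : seq nat) :
  0 < m -> size s <= t -> {in s, forall d, 0 < d <= m} ->
  \prod_(d <- s) d \in bounded_products t m.
Proof.
move=> m0; elim: t s => [|t IHt] s; first by case: s => // _ _; rewrite big_nil.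
case: s => [|d s] /= st sm.
  (* A sequence shorter than [t] is padded with factors 1. *)
  rewrite big_nil; apply/allpairsP; exists (1, 1); split => //=.
    by rewrite mem_iota; lia.
  by have := IHt [::] isT; rewrite big_nil; apply.
rewrite big_cons; apply/allpairsP; exists (d, \prod_(d <- s) d); split => //=.
  by rewrite mem_iota; have := sm d (mem_head _ _); lia.
by apply: IHt => // c cs; apply: sm; rewrite inE cs orbT.
Qed.

(* At most [s] of the entries are at most [s], and at most [s] exceed [s]. *)
Lemma size_uniq_sum_le s (l : seq nat) :
  uniq l -> {in l, forall d, 0 < d} -> \sum_(d <- l) d <= s ^ 2 ->
  size l <= 2 * s.
Proof.
move=> ul l0 ls.
rewrite -(count_predC (fun d => d <= s)) mul2n -addnn -!size_filter leq_add //.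
  rewrite -[X in _ <= X](size_iota 1); apply: uniq_leq_size.
    exact: filter_uniq.
  by move=> d; rewrite mem_filter mem_iota => /andP [? /l0]; lia.
have : \sum_(d <- [seq d <- l | predC (fun d => d <= s) d]) s.+1 <= s ^ 2.
  apply: leq_trans ls; rewrite big_filter [X in _ <= X](bigID (fun d => d <= s)).
  apply: leq_trans (leq_addl _ _).
  by apply: leq_sum => d /=; rewrite -ltnNge.
rewrite big_const_seq count_predT iter_addn_0.
by move: (size _) => c; nia.
Qed.

(** If [d] is the order of [x], then all [d] points of the orbit of [x] have order [d]. Points
    counted for different values of [d] are different. *)
Lemma sum_order_le (T : finType) (f : T -> T) : injective f ->
  \sum_(d <- undup (codom (order f))) d <= #|T|.
Proof.
move=> f_inj; set l := undup _.
have ul : uniq l := undup_uniq _.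
apply: (@leq_trans (\sum_(d <- l) #|[pred x | order f x == d]|)).
  rewrite big_seq [X in _ <= X]big_seq; apply: leq_sum => d.
  rewrite mem_undup => /codomP [x ->].
  apply: subset_leq_card; apply/fintype.subsetP => y xy.
  rewrite inE; apply/eqP; apply: (eq_order_cycle (cycle_orbit f_inj x)).
    exact: in_orbit.
  by rewrite -fconnect_orbit.
under eq_bigr do rewrite -sum1_card big_mkcond /=.
rewrite exchange_big /= -sum1_card; apply: leq_sum => x _.
rewrite -big_mkcond /= sum1_count (eq_count (a2 := pred1 (order f x))).
  by rewrite count_uniq_mem // leq_b1.
by move=> d; rewrite inE /= eq_sym.
Qed.

(** The exponent is the product of the distinct orbit lengths. Each orbit length divides it, and
    there are at most [2 * s] factors because they sum to at most [s ^ 2]. *)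
Lemma injective_iter_exponent (T : finType) (f : T -> T) s : injective f ->
  0 < s -> #|T| <= s ^ 2 ->
  exists2 e, e \in bounded_products (2 * s) (s ^ 2) & forall x, iter e f x = x.
Proof.
move=> f_inj s0 Ts; set l := undup (codom (order f)).
have lP d : d \in l -> 0 < d <= #|T|.
  by rewrite mem_undup => /codomP [x ->]; rewrite order_gt0 max_card.
exists (\prod_(d <- l) d).
  apply: prod_in_bounded_products; first by rewrite expn_gt0 s0.
    apply: size_uniq_sum_le; first exact: undup_uniq.
      by move=> d /lP /andP [].
    exact: leq_trans (sum_order_le f_inj) Ts.
  by move=> d /lP /andP [-> /leq_trans]; apply.
move=> x.
have xl : order f x \in l by rewrite mem_undup codom_f.
rewrite (big_rem _ xl) /= mulnC.
elim: (\prod_(d <- _) d) => //= n IHn.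
by rewrite mulSn iterD IHn iter_order.
Qed.

(** * Normal cores and the action on cosets *)

Section Subgroups.
Local Open Scope group_scope.
Variable G : groupType.
Implicit Types (D N : set G) (g h x : G).

Lemma subgroup1 D : subgroup D -> D 1.
Proof. by case=> /set_mem. Qed.

Lemma subgroupV D x : subgroup D -> D x -> D x^-1.
Proof. by move=> /group_closedV DV /mem_set /DV /set_mem. Qed.

Lemma subgroupM D x y : subgroup D -> D x -> D y -> D (x * y).
Proof. by move=> /group_closedM DM /mem_set Dx /mem_set /(DM _ _ Dx)/set_mem. Qed.

Lemma subgroupP D : D 1 -> (forall x y, D x -> D y -> D (x * y)) ->
  (forall x, D x -> D x^-1) -> subgroup D.
Proof.
move=> D1 DM DV; split; first exact: mem_set.
by move=> x y /set_mem Dx /set_mem Dy; apply/mem_set/DM => //; apply: DV.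
Qed.

Definition normal_subgroup N :=
  subgroup N /\ forall x g, N x -> N (x ^ g).

(** For a subgroup [D] this is the kernel of the action on left cosets, since [g] fixes the coset of
    [h] exactly when [g ^ h] is in [D]. *)
Definition subgroup_core D : set G := [set g | forall h, D (g ^ h)].

Lemma subgroup_core_normal D : subgroup D -> normal_subgroup (subgroup_core D).
Proof.
move=> sD; split; last by move=> x g Dx h; rewrite -conjgM; apply: Dx.
apply: subgroupP => [h|x y Dx Dy h|x Dx h].
- by rewrite conj1g; apply: subgroup1.
- by rewrite conjMg; apply: subgroupM.
- by rewrite conjVg; apply: subgroupV.
Qed.

Lemma subgroup_core_sub D : subgroup_core D `<=` D.
Proof. by move=> x /(_ 1); rewrite conjg1. Qed.

Lemma left_cosetE D g h : subgroup D ->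
  ([set g * x | x in D] = [set h * x | x in D]) <-> D (g^-1 * h).
Proof.
move=> sD; split=> [gh|Dgh].
  have : [set h * x | x in D] h by exists 1; [exact: subgroup1|rewrite mulg1].
  by rewrite -gh => -[x Dx <-]; rewrite mulKg.
apply/seteqP; split=> _ [x Dx <-].
  exists ((g^-1 * h)^-1 * x); first by apply: subgroupM => //; apply: subgroupV.
  by rewrite invgM invgK !mulgA mulgV mul1g.
exists (g^-1 * h * x); first exact: subgroupM.
by rewrite !mulgA mulgV mul1g.
Qed.

(** Numbering the cosets by ['I_k], with representatives [r], turns the coset action into self-maps
    of a finite type. *)
Lemma has_index_label D k : subgroup D -> has_index D k ->
  exists lab : G -> 'I_k,
    (forall g h, lab g = lab h <-> D (g^-1 * h)) /\
    exists r, cancel r lab.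
Proof.
move=> sD /card_set_bijP [phi [phiI phi_inj phi_surj]].
pose C g := [set g * x | x in D].
have CD g : left_cosets D (C g) by exists g.
pose lab g := Ordinal (phiI _ (CD g)).
exists lab; split=> [g h|].
  rewrite -left_cosetE //; split=> [[ghE]|gh].
    by apply: phi_inj => //; apply/mem_set/CD.
  by apply: val_inj => /=; rewrite /C gh.
have /choice [r rE] : forall i : 'I_k, exists g, lab g = i.
  move=> i; have [_ [g ->] gi] := phi_surj i (ltn_ord i).
  by exists g; apply: val_inj.
by exists r.
Qed.

Lemma subgroup_core_exponent D k s x : subgroup D -> has_index D k ->
  (0 < s)%N -> (k <= s ^ 2)%N ->
  exists2 e, e \in bounded_products (2 * s) (s ^ 2) & subgroup_core D (x ^+ e).
Proof.
move=> sD Dk s0 ks; have [lab [labE [r rK]]] := has_index_label sD Dk.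
pose f i := lab (x * r i).
(* The choice of representative is immaterial: [r (lab g)] and [g] lie in the same left coset. *)
have fE g : f (lab g) = lab (x * g).
  by apply/labE; rewrite invgM -mulgA mulKg; apply/labE; rewrite rK.
have f_inj : injective f.
  move=> i j /labE; rewrite invgM -mulgA mulKg => /labE.
  by rewrite !rK.
have [|e eP fe] := injective_iter_exponent f_inj s0; first by rewrite card_ord.
exists e => // h.
have fn n : iter n f (lab h) = lab (x ^+ n * h).
  by elim: n => [|n IHn] /=; rewrite ?expg0 ?mul1g // IHn fE expgS mulgA.
by have := fn e; rewrite fe => /labE; rewrite conjgE.
Qed.

End Subgroups.

(** * Calculus of words *)

Section Words.
Local Open Scope group_scope.
Variable G : groupType.
Implicit Types (u v w : seq (G * bool)) (S : set G).

Lemma word_val_nil : word_val [::] = 1 :> G.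
Proof. exact: big_nil. Qed.

Lemma word_val_cons (a : G * bool) w :
  word_val (a :: w) = (if a.2 then a.1^-1 else a.1) * word_val w.
Proof. exact: big_cons. Qed.

Lemma word_val_cat u v : word_val (u ++ v) = word_val u * word_val v.
Proof. exact: big_cat. Qed.

Lemma word_on_cat S u v : word_on S u -> word_on S v -> word_on S (u ++ v).
Proof. by move=> Su Sv a; rewrite mem_cat => /orP [/Su|/Sv]. Qed.

Lemma word_on_cons S (a : G * bool) w :
  S a.1 -> word_on S w -> word_on S (a :: w).
Proof. by move=> Sa Sw b; rewrite inE => /orP [/eqP->|/Sw]. Qed.

Definition inv_word w := rev [seq (a.1, ~~ a.2) | a <- w].

Lemma size_inv_word w : size (inv_word w) = size w.
Proof. by rewrite size_rev size_map. Qed.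

Lemma word_on_inv S w : word_on S w -> word_on S (inv_word w).
Proof. by move=> Sw a; rewrite mem_rev => /mapP [b /Sw ? ->]. Qed.

Lemma word_val_inv w : word_val (inv_word w) = (word_val w)^-1.
Proof.
elim: w => [|[x b] w IHw]; first by rewrite /inv_word word_val_nil invg1.
rewrite /inv_word /= rev_cons -cats1 word_val_cat IHw !word_val_cons.
by rewrite word_val_nil mulg1 invgM; case: b; rewrite /= ?invgK.
Qed.

Lemma reduced_inv w : reduced (inv_word w) = reduced w.
Proof.
rewrite /reduced rev_sorted sorted_map; case: w => //= a w.
by apply: eq_path => -[x b] [y c] /=; rewrite eq_sym; case: b c => [] [].
Qed.

Lemma map_fst_inv w : map fst (inv_word w) = rev (map fst w).
Proof. by rewrite map_rev -map_comp. Qed.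

Lemma generates_word S g : generates S -> exists2 w, word_on S w & word_val w = g.
Proof.
pose V : set G := [set g | exists2 w, word_on S w & word_val w = g].
move=> /(_ V) gen; suff VT : V = setT by have : V g by rewrite VT.
apply: gen => [|x Sx].
  apply: subgroupP => [|_ _ [u Su <-] [v Sv <-]|_ [u Su <-]].
  - by exists [::] => //; rewrite word_val_nil.
  - by exists (u ++ v); [exact: word_on_cat|rewrite word_val_cat].
  - by exists (inv_word u); [exact: word_on_inv|rewrite word_val_inv].
exists [:: (x, false)]; first exact: word_on_cons.
by rewrite word_val_cons word_val_nil mulg1.
Qed.

(** This transfers a word in [p] and [q] to the generating set [X] at the cost of a constant factor
    in length. *)
Lemma word_subst S P M w :
  (forall x, P x -> exists v, [/\ word_on S v, word_val v = x & size v <= M]%N) ->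
  word_on P w ->
  exists v, [/\ word_on S v, word_val v = word_val w & size v <= M * size w]%N.
Proof.
move=> PS; elim: w => [_|[x b] w IHw Pw]; first by exists [::].
have [v [Sv vE vM]] : exists v, [/\ word_on S v, word_val v = word_val w
    & size v <= M * size w]%N.
  by apply: IHw => a aw; apply: Pw; rewrite inE aw orbT.
have [u [Su uE uM]] := PS x (Pw _ (mem_head _ _)).
exists ((if b then inv_word u else u) ++ v); split.
- by apply: word_on_cat => //; case: b {Pw} => //; apply: word_on_inv.
- by rewrite word_val_cat vE word_val_cons /=; case: b {Pw}; rewrite ?word_val_inv uE.
- rewrite size_cat /= mulnS; apply: leq_add => //.
  by case: b {Pw} => //; rewrite size_inv_word.
Qed.

Lemma commute_words S u v :
  (forall x y, S x -> S y -> x * y = y * x) -> word_on S u -> word_on S v ->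
  word_val u * word_val v = word_val v * word_val u.
Proof.
move=> SC Su Sv; rewrite /word_val.
rewrite (big_seq _ _ u) (big_seq _ _ v).
apply: commute_prod => a /Sv Sa; apply/commute_sym/commute_prod => b /Su Sb.
have ab : commute a.1 b.1 by apply: SC.
have aVb : commute a.1^-1 b.1 by apply/commute_sym/commuteV/commute_sym.
by case: a.2 b.2 => [] [] //; apply: commuteV.
Qed.

End Words.

(** * Reduced words for iterated commutators *)

Section CommutatorWords.
Local Open Scope group_scope.
Variables (G : groupType) (p q : G).
Hypothesis pq : p != q.
Implicit Types (u v w : seq (G * bool)).

(** The default [q] excludes the empty word when [p != q]. Signs of the end letters are ignored, so
    that the notion is stable under inversion. *)
Definition bordered u :=
  [&& reduced u, head q (map fst u) == p & last q (map fst u) == p].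

Lemma bordered_inv u : bordered u -> bordered (inv_word u).
Proof.
case/and3P => ru hu lu; rewrite /bordered reduced_inv ru map_fst_inv /=.
move: hu lu; case/lastP: (map fst u) => [? ?|s x]; first exact/andP.
rewrite last_rcons rev_rcons /=.
by case: s => [|y s] /= hu ->; rewrite ?rev_cons ?last_rcons.
Qed.

Let nc (a b : G * bool) := ~~ ((a.1 == b.1) && (a.2 != b.2)).

(** Both junctions of [u] with its neighbours pair a letter over [p] with one over [q], so no
    cancellation occurs there. *)
Lemma path_bordered a b u v : bordered u -> a.1 = q -> b.1 = q ->
  path nc a (u ++ b :: v) = path nc b v.
Proof.
case: u => [|c u]; first by rewrite /bordered /= eq_sym (negbTE pq) andbF.
case/and3P => /= ru /eqP hu /eqP; rewrite last_map => lu aq bq.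
rewrite cat_path /= -/nc in ru *; rewrite ru.
by rewrite {1 2}/nc aq bq hu lu (eq_sym q) (negbTE pq).
Qed.

(* The word p [u, q v q^-1] p^-1: the letters q separate the bordered blocks,
   so nothing cancels, and conjugating by p makes the result bordered again. *)
Definition comm_word u v :=
  (p, false) :: u ++ (q, false) :: v ++ (q, true) :: inv_word u ++
    (q, false) :: inv_word v ++ [:: (q, true); (p, true)].

Lemma bordered_comm_word u v : bordered u -> bordered v ->
  head (q, false) u = (p, false) -> bordered (comm_word u v).
Proof.
move=> bu bv hu; have bu' := bordered_inv bu; have bv' := bordered_inv bv.
apply/and3P; split; [|exact: eqxx|]; last first.
  by rewrite /= !(map_cat, last_cat, map_cons, last_cons) /=.
(* The initial letter [p] may be replaced by [q]: as [u] starts with [p] and not its inverse,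
   neither cancels against it. Every block then stands between letters over [q]. *)
have -> : reduced (comm_word u v) =
    path nc (q, false) (u ++ drop (size u).+1 (comm_word u v)).
  rewrite /comm_word -cat1s /= drop_size_cat //.
  case: u bu {bu'} hu => [|c u] _ /= => [[qp]|->].
    by move: pq; rewrite qp eqxx.
  by rewrite /nc /= eqxx eq_sym (negbTE pq).
rewrite /= drop_size_cat // !path_bordered //=.
by rewrite /nc /= eq_sym (negbTE pq).
Qed.

Lemma word_val_comm_word u v : word_val (comm_word u v) =
  (word_val u * (word_val u)^-1 ^ (word_val v ^ q^-1)^-1) ^ p^-1.
Proof.
rewrite /comm_word !(word_val_cons, word_val_cat, word_val_inv, word_val_nil) /=.
by rewrite !conjgE !invgM !invgK !mulgA !mulg1.
Qed.

Lemma size_comm_word u v :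
  size (comm_word u v) = (2 * size u + 2 * size v + 6)%N.
Proof.
by rewrite /comm_word; do 4!rewrite /= size_cat ?size_inv_word; rewrite /=; lia.
Qed.

Lemma word_on_comm_word S u v : S p -> S q -> word_on S u -> word_on S v ->
  word_on S (comm_word u v).
Proof.
move=> Sp Sq Su Sv.
by do ?[apply: word_on_cons => //|apply: word_on_cat => //|apply: word_on_inv].
Qed.

Lemma normal_comm_word N u v : normal_subgroup N ->
  N (word_val u) \/ N (word_val v) -> N (word_val (comm_word u v)).
Proof.
case=> sN nN Nuv; rewrite word_val_comm_word; apply: (nN); case: Nuv => Nw.
  by apply: subgroupM => //; apply: (nN); apply: subgroupV.
move: (word_val v ^ q^-1) (nN _ q^-1 Nw) => b Nb.
(* With [a] the value of [u], the commutator is regrouped as the conjugate [a * b * a^-1] times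
   [b^-1]. *)
rewrite conjgE invgK !mulgA; apply: subgroupM => //; last exact: subgroupV.
by have := nN _ (word_val u)^-1 Nb; rewrite conjgE invgK mulgA.
Qed.

(** The list is halved at each level of the tree, down to leaves [p ^+ n]. The summand 2 absorbs the
    constant 6 of [size_comm_word]: size plus 2 is twice the sum of the same quantities for the two
    subtrees, so it grows at most fourfold per level. *)
Lemma comm_word_tree d L (es : seq nat) : (0 < L)%N -> (size es <= 2 ^ d)%N ->
  {in es, forall n, 0 < n <= L}%N ->
  exists w, [/\ word_on [set p; q] w, bordered w, head (q, false) w = (p, false),
    (size w + 2 <= 4 ^ d * (L + 2))%N
    & forall N, normal_subgroup N -> (exists2 n, n \in es & N (p ^+ n)) ->
        N (word_val w)].
Proof.
move=> L0; elim: d es => [|d IHd] es esd esL.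
  (* A half may be empty; its leaf is then [p] itself. *)
  pose n := head 1%N es.
  have /andP [n0 nL] : (0 < n <= L)%N.
    by rewrite /n; case: es esL {esd n} => [_|n es esL] /=; rewrite ?L0 // esL ?mem_head.
  exists (nseq n (p, false)); split.
  - by move=> a /nseqP [-> _]; left.
  - rewrite /bordered /reduced; case: n n0 {nL} => //= n _; rewrite eqxx /=.
    rewrite map_nseq; apply/andP; split; last by elim: n => //= n ->.
    by elim: n => //= n ->; rewrite eqxx.
  - by case: n n0 {nL}.
  - by rewrite size_nseq expn0 mul1n leq_add2r.
  - move=> N sN [m mes]; suff -> : word_val (nseq n (p, false)) = p ^+ m by [].
    have -> : m = n.
      rewrite /n; case: es esd mes {esL n n0 nL} => [|c [|]] //= _.
      by rewrite inE => /eqP.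
    by elim: (n) => [|k IHk]; rewrite ?word_val_nil ?expg0 //= word_val_cons IHk expgS.
have [||u [Su bu hu su Nu]] := IHd (take (2 ^ d) es).
- by rewrite size_take_min geq_minl.
- by move=> n /mem_take /esL.
have [||v [Sv bv hv sv Nv]] := IHd (drop (2 ^ d) es).
- by rewrite size_drop; move: esd; rewrite expnS; lia.
- by move=> n /mem_drop /esL.
exists (comm_word u v); split => //.
- by apply: word_on_comm_word => //; [left|right].
- exact: bordered_comm_word.
- by rewrite size_comm_word expnS; move: su sv; lia.
- move=> N sN [n]; rewrite -{1}(cat_take_drop (2 ^ d) es) mem_cat => nes Npn.
  apply: normal_comm_word => //; case/orP: nes => nes; [left|right].
    by apply: Nu => //; exists n.
  by apply: Nv => //; exists n.
Qed.

End CommutatorWords.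

(** * Short nontrivial elements in all subgroups of small index *)

Section FreeSubgroup.
Local Open Scope group_scope.
Variable G : groupType.

Lemma free_basis_word_neq1 (H S : set G) w : H 1 -> free_basis H S ->
  word_on S w -> reduced w -> w <> [::] -> word_val w <> 1.
Proof.
move=> H1 [_ /(_ 1 H1)[v [_ v_uniq]]] Sw rw w0 w1; apply: w0.
rewrite -(v_uniq w) // -(v_uniq [::]) //.
by split=> //; apply: word_val_nil.
Qed.

(** With at most one basis element all letters commute, hence so do all values of words. *)
Lemma nonabelian_basis (H S : set G) : nonabelian H -> free_basis H S ->
  exists p q, [/\ S p, S q & p != q].
Proof.
move=> [x [y [Hx Hy xy]]] [_ basis]; apply: contrapT => noS; apply: xy.
have [u [[Su _ <-] _]] := basis x Hx; have [v [[Sv _ <-] _]] := basis y Hy.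
apply: commute_words Su Sv => p q Sp Sq.
have [->//|pq] := eqVneq p q.
by case: noS; exists p, q.
Qed.

Lemma free_subgroup_deep_word (H : set G) : free_subgroup H -> nonabelian H ->
  exists p q, forall j, exists w,
    [/\ word_on [set p; q] w, word_val w <> 1,
        (size w <= 2 ^ (12 * (j * 2 ^ j) + 2))%N
      & forall (D : set G) k, subgroup D -> has_index D k -> (k <= 4 ^ j)%N ->
          D (word_val w)].
Proof.
move=> [sH [S bS]] nabH; have [p [q [Sp Sq pq]]] := nonabelian_basis nabH bS.
(* For [s] a power of 2, the number of exponents and the bound on each of them are both exactly
   [2 ^ d]. A tree of depth [d] thus has length at most [4 ^ d * (2 ^ d + 2)], which is at most
   [2 ^ (3 * d + 2)]. *)
exists p, q => j; pose s := (2 ^ j)%N; pose d := (4 * (j * s))%N.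
have s2E : (s ^ 2 = 4 ^ j)%N by rewrite -expnM mulnC expnM.
have dE : ((s ^ 2) ^ (2 * s) = 2 ^ d)%N.
  by rewrite -!expnM; congr (_ ^ _)%N; rewrite /d; lia.
have [|||w [Sw bw hw sw Nw]] :=
    @comm_word_tree _ _ _ pq d (2 ^ d) (bounded_products (2 * s) (s ^ 2)).
- by rewrite expn_gt0.
- by rewrite size_bounded_products dE.
- by move=> n /bounded_products_bound; rewrite dE.
exists w; split=> //.
- apply: (free_basis_word_neq1 (subgroup1 sH) bS).
  + by move=> a /Sw [] ->.
  + by case/and3P: bw.
  + by move=> w0; move: hw pq; rewrite w0 => -[->]; rewrite eqxx.
- have -> : (12 * (j * 2 ^ j) + 2 = 2 * d + (d + 2))%N by rewrite /d /s; lia.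
  have d4E : (4 ^ d = 2 ^ (2 * d))%N by rewrite expnM.
  rewrite d4E in sw; rewrite expnD; apply: leq_trans (leq_addr 2 _) (leq_trans sw _).
  rewrite leq_mul2l; apply/orP; right; rewrite expnD.
  by have : (0 < 2 ^ d)%N; [rewrite expn_gt0|lia].
- move=> D k sD Dk kj; apply: subgroup_core_sub; apply: Nw.
    exact: subgroup_core_normal.
  apply: subgroup_core_exponent sD Dk _ _; first by rewrite expn_gt0.
  by rewrite s2E.
Qed.

End FreeSubgroup.

(** * Comparison with the logarithm *)

Lemma exp4_dominates (A B : nat) :
  exists j, A + B * (j * 2 ^ j) < 4 ^ j.
Proof.
(* With [e = 2 ^ i], the left side is [A + 2 * B * i * e ^ 2], at most [i * e ^ 3], and the right
   side is [e ^ 4]. *)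
pose i := A + 2 * B; exists (2 * i).
have i2 : i < 2 ^ i by apply: ltn_expl.
have -> : 4 ^ (2 * i) = (2 ^ i) * (2 ^ i) * (2 ^ i) * (2 ^ i).
  by rewrite -!expnD -[4 ^ _](expnM 2 2); congr (_ ^ _); lia.
have -> : 2 ^ (2 * i) = 2 ^ i * 2 ^ i by rewrite -expnD mul2n addnn.
move: (2 ^ i) i2 => e ie.
apply: (@leq_ltn_trans (i * (e * e * e))); last first.
  by rewrite [X in _ < X]mulnC ltn_mul2r ie !muln_gt0; lia.
rewrite {2}/i mulnDl leq_add //.
  by rewrite leq_pmulr // !muln_gt0; lia.
rewrite -!mulnA [X in _ <= X]mulnCA leq_mul2l; apply/orP; right.
by rewrite leq_mul2l leq_mul2r (ltnW ie) orbT.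
Qed.

Section Growth.
Variable R : realType.
Local Open Scope ring_scope.

(** This crude bound uses [a < 2 ^ a] and [ln 2 <= 1], the latter from [1 + 1 <= expR 1]. *)
Lemma ln_natr_le (a e n : nat) : (0 < n <= a * 2 ^ e)%N ->
  ln (n%:R : R) <= (a + e)%:R.
Proof.
move=> /andP [n0 na].
have n2 : (n <= 2 ^ (a + e))%N.
  by apply: leq_trans na _; rewrite expnD leq_mul2r ltnW ?orbT // ltn_expl.
apply: (@le_trans _ _ (ln (2 ^ (a + e))%:R)).
  by rewrite ler_ln ?posrE ?ltr0n ?expn_gt0 // ler_nat.
rewrite natrX lnXn // -[leLHS]mulr_natl ler_piMr //.
rewrite -[leRHS]expRK ler_ln ?posrE ?expR_gt0 //.
exact: expR_ge1Dx.
Qed.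

Lemma word_length_le (G : groupType) (X : set G) w :
  word_on X w -> (word_length R X (word_val w) <= (size w)%:R%:E)%E.
Proof. by move=> Xw; apply: ereal_inf_lbound; exists (size w) => //; exists w. Qed.

Lemma divisibility_ge (G : groupType) (g : G) m :
  (forall (D : set G) k, subgroup D -> has_index D k -> (k <= m)%N -> D g) ->
  (m%:R%:E <= divisibility R g)%E.
Proof.
move=> Dg; apply/ereal_infP => _ [k [D [sD Dk nDg]] <-].
rewrite lee_fin ler_nat leqNgt; apply/negP => /ltnW km.
exact/nDg/(Dg D k).
Qed.

End Growth.

Theorem corollary5p1 (R : realType) (G : groupType) (X : set G)
  (finX : finite_set X) (genX : generates X)
  (freeG : exists H : set G, free_subgroup H /\ nonabelian H) :
  ~ preceq (max_divisibility R X) (fun n : nat => (ln (n%:R : R))%:E).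
Proof.
case: freeG => H [freeH nabH] [C [C0 divC]].
have [p [q pqP]] := free_subgroup_deep_word freeH nabH.
have [u Xu up] := generates_word p genX; have [v Xv vq] := generates_word q genX.
pose M := (size u + size v).+1.
(* The word has length at most [n = M * 2 ^ e] over [X], where [e = 12 * (j * 2 ^ j) + 2], and
   [ln (C * n)] is at most [C * M + e]. So [j] is chosen to make [C * (C * M + e)] smaller than
   [4 ^ j]. *)
have [j jP] := exp4_dominates (C * (C * M + 2)) (12 * C).
have [w [pqw w1 sw Dw]] := pqP j.
have [x [Xx xE sx]] : exists x, [/\ word_on X x, word_val x = word_val w
    & size x <= M * size w].
  apply: word_subst pqw => _ [] ->; [exists u|exists v]; split=> //; lia.
pose e := 12 * (j * 2 ^ j) + 2; pose n := M * 2 ^ e.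
have n0 : 0 < n by rewrite muln_gt0 expn_gt0.
suff : ((4 ^ j)%:R%:E <= (C * (C * M + e))%:R%:E :> \bar R)%E.
  by rewrite lee_fin ler_nat /e; move: jP; lia.
apply: (@le_trans _ _ (max_divisibility R X n)).
  apply: le_trans (divisibility_ge _ Dw) (ereal_sup_ubound _).
  exists (word_val w) => //; split=> //; rewrite -xE.
  apply: le_trans (word_length_le _ Xx) _.
  by rewrite lee_fin ler_nat (leq_trans sx) // leq_mul2l sw orbT.
apply: le_trans (divC n n0) _.
rewrite -EFinM lee_fin [leRHS]natrM ler_wpM2l // ln_natr_le //.
by rewrite muln_gt0 C0 n0 mulnA leqnn.
Qed.
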